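(* Let $\overline{E},\underline{E},\overline{P^{\mathrm C}},\overline{P^{\mathrm D}},R^+,R^-,\eta^{\mathrm C},\eta^{\mathrm D},\Delta$ be real parameters with $\overline{E}>\underline{E}\ge 0$, $\Delta>0$, $0<\eta^{\mathrm C},\eta^{\mathrm D}\le 1$, $0\le \overline{P^{\mathrm C}},R^-\le \frac{1}{\eta^{\mathrm C}\Delta}(\overline{E}-\underline{E})$ and $0\le\overline{P^{\mathrm D}},R^+\le \frac{\eta^{\mathrm D}}{\Delta}(\overline{E}-\underline{E})$. Let $S$ be the feasible set of the one-period basic storage operation model with reserves (BOR-MIP), and let $P$ be the feasible set of the one-period linear relaxation TOR-LP of the tighter model with reserves, both defined in the context as subsets of $\mathbb{R}^{11}$. Then $P=\operatorname{conv}(S)$.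
   Context: Fix one time period $t$. Variables, all real: $e_{t-1},e_t$ (state of charge at the end of periods $t-1$ and $t$), $p^{\mathrm C}_t,p^{\mathrm D}_t$ (charged/discharged power), $r^{\mathrm C+}_t,r^{\mathrm C-}_t,r^{\mathrm D+}_t,r^{\mathrm D-}_t$ (up/down reserves from charging and discharging), $r^+_t,r^-_t$ (total up/down reserves), $\delta_t$ (charging indicator). $\operatorname{conv}$ denotes the convex hull. BOR-MIP for one period: $S$ is the set of all vectors $(e_{t-1},e_t,p^{\mathrm C}_t,p^{\mathrm D}_t,r^{\mathrm C+}_t,r^{\mathrm C-}_t,r^{\mathrm D+}_t,r^{\mathrm D-}_t,r^+_t,r^-_t,\delta_t)\in\mathbb{R}^{11}$ with - $e_t=e_{t-1}+\eta^{\mathrm C}p^{\mathrm C}_t\Delta-\frac{1}{\eta^{\mathrm D}}p^{\mathrm D}_t\Delta$, - $\underline{E}\le e_{t-1}\le\overline{E}$, - $e_t\ge\underline{E}+\eta^{\mathrm C}r^{\mathrm C+}_t\Delta+\frac{1}{\eta^{\mathrm D}}r^{\mathrm D+}_t\Delta$, - $e_t\le\overline{E}-\eta^{\mathrm C}r^{\mathrm C-}_t\Delta-\frac{1}{\eta^{\mathrm D}}r^{\mathrm D-}_t\Delta$, - $p^{\mathrm C}_t+r^{\mathrm C-}_t\le\overline{P^{\mathrm C}}\,\delta_t$, - $p^{\mathrm D}_t+r^{\mathrm D+}_t\le\overline{P^{\mathrm D}}(1-\delta_t)$, - $p^{\mathrm C}_t-r^{\mathrm C+}_t\ge0$, $\;p^{\mathrm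 D}_t-r^{\mathrm D-}_t\ge0$, - $r^-_t=r^{\mathrm C-}_t+r^{\mathrm D-}_t\le R^-$, $\;r^+_t=r^{\mathrm C+}_t+r^{\mathrm D+}_t\le R^+$, - $e_{t-1},e_t,p^{\mathrm C}_t,p^{\mathrm D}_t,r^{\mathrm C+}_t,r^{\mathrm C-}_t,r^{\mathrm D+}_t,r^{\mathrm D-}_t\ge0$, - $\delta_t\in\{0,1\}$. TOR-LP for one period: $P$ is the set of all such vectors in $\mathbb{R}^{11}$ with - $e_t=e_{t-1}+\eta^{\mathrm C}p^{\mathrm C}_t\Delta-\frac{1}{\eta^{\mathrm D}}p^{\mathrm D}_t\Delta$, - $e_{t-1}\ge\underline{E}+\frac{1}{\eta^{\mathrm D}}p^{\mathrm D}_t\Delta+\frac{1}{\eta^{\mathrm D}}r^{\mathrm D+}_t\Delta$, - $e_{t-1}\le\overline{E}-\eta^{\mathrm C}p^{\mathrm C}_t\Delta-\eta^{\mathrm C}r^{\mathrm C-}_t\Delta$, - $p^{\mathrm C}_t+r^{\mathrm C-}_t\le\overline{P^{\mathrm C}}\,\delta_t$, - $p^{\mathrm D}_t+r^{\mathrm D+}_t\le\overline{P^{\mathrm D}}(1-\delta_t)$, - $p^{\mathrm C}_t-r^{\mathrm C+}_t\ge0$, $\;p^{\mathrm D}_t-r^{\mathrm D-}_t\ge0$, - $r^{\mathrm C-}_t\le R^-\delta_t$, $\;r^{\mathrm D-}_t\le R^-(1-\delta_t)$, $\;r^{\mathrm C+}_t\le R^+\delta_t$, $\;r^{\mathrm D+}_t\le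 R^+(1-\delta_t)$, - $r^-_t=r^{\mathrm C-}_t+r^{\mathrm D-}_t$, $\;r^+_t=r^{\mathrm C+}_t+r^{\mathrm D+}_t$, - $e_{t-1},e_t,p^{\mathrm C}_t,p^{\mathrm D}_t,r^{\mathrm C+}_t,r^{\mathrm C-}_t,r^{\mathrm D+}_t,r^{\mathrm D-}_t\ge0$, - $0\le\delta_t\le1$. *)

(* Defs.v *)
From mathcomp Require Import all_boot all_order all_algebra.
From mathcomp Require Import classical_sets reals convex.
Set Implicit Arguments.
Unset Strict Implicit.
Unset Printing Implicit Defensive.
Import Order.TTheory GRing.Theory Num.Theory.
Local Open Scope classical_set_scope.
Local Open Scope ring_scope.

Definition convex_hull (R : realType) (V : lmodType R) (A : set V) : set V :=
  smallest (@convex_set R V) A.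

(* A point of R^11 is a row vector, with coordinates in the order
   (e_{t-1}, e_t, p^C, p^D, r^{C+}, r^{C-}, r^{D+}, r^{D-}, r^+, r^-, delta). *)
Definition soc_prev (R : realType) (x : 'rV[R]_11) : R := x 0 (@Ordinal 11 0 isT).
Definition soc (R : realType) (x : 'rV[R]_11) : R := x 0 (@Ordinal 11 1 isT).
Definition pC (R : realType) (x : 'rV[R]_11) : R := x 0 (@Ordinal 11 2 isT).
Definition pD (R : realType) (x : 'rV[R]_11) : R := x 0 (@Ordinal 11 3 isT).
Definition rCup (R : realType) (x : 'rV[R]_11) : R := x 0 (@Ordinal 11 4 isT).
Definition rCdn (R : realType) (x : 'rV[R]_11) : R := x 0 (@Ordinal 11 5 isT).
Definition rDup (R : realType) (x : 'rV[R]_11) : R := x 0 (@Ordinal 11 6 isT).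
Definition rDdn (R : realType) (x : 'rV[R]_11) : R := x 0 (@Ordinal 11 7 isT).
Definition rup (R : realType) (x : 'rV[R]_11) : R := x 0 (@Ordinal 11 8 isT).
Definition rdn (R : realType) (x : 'rV[R]_11) : R := x 0 (@Ordinal 11 9 isT).
Definition delta (R : realType) (x : 'rV[R]_11) : R := x 0 (@Ordinal 11 10 isT).

(* The totals r^+ and r^- carry no sign constraint of their own. *)
Definition nonneg_vars (R : realType) (x : 'rV[R]_11) : Prop :=
  [/\ 0 <= soc_prev x, 0 <= soc x, 0 <= pC x & 0 <= pD x] /\
  [/\ 0 <= rCup x, 0 <= rCdn x, 0 <= rDup x & 0 <= rDdn x].

Definition soc_balance (R : realType) (etaC etaD Delta : R) (x : 'rV[R]_11) : Prop :=
  soc x = soc_prev x + etaC * pC x * Delta - 1 / etaD * pD x * Delta.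

(* BOR-MIP: basic storage operation model with reserves, one period. *)
Definition BOR_MIP (R : realType)
    (Emax Emin PCmax PDmax Rup Rdn etaC etaD Delta : R) : set 'rV[R]_11 :=
  [set x |
    soc_balance etaC etaD Delta x /\
    Emin <= soc_prev x <= Emax /\
    soc x >= Emin + etaC * rCup x * Delta + 1 / etaD * rDup x * Delta /\
    soc x <= Emax - etaC * rCdn x * Delta - 1 / etaD * rDdn x * Delta /\
    pC x + rCdn x <= PCmax * delta x /\
    pD x + rDup x <= PDmax * (1 - delta x) /\
    pC x - rCup x >= 0 /\
    pD x - rDdn x >= 0 /\
    (rdn x = rCdn x + rDdn x /\ rdn x <= Rdn) /\
    (rup x = rCup x + rDup x /\ rup x <= Rup) /\
    nonneg_vars x /\
    (delta x = 0 \/ delta x = 1)].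

(* TOR-LP: linear relaxation of the tighter model with reserves, one period. *)
Definition TOR_LP (R : realType)
    (Emax Emin PCmax PDmax Rup Rdn etaC etaD Delta : R) : set 'rV[R]_11 :=
  [set x |
    soc_balance etaC etaD Delta x /\
    soc_prev x >= Emin + 1 / etaD * pD x * Delta + 1 / etaD * rDup x * Delta /\
    soc_prev x <= Emax - etaC * pC x * Delta - etaC * rCdn x * Delta /\
    pC x + rCdn x <= PCmax * delta x /\
    pD x + rDup x <= PDmax * (1 - delta x) /\
    pC x - rCup x >= 0 /\
    pD x - rDdn x >= 0 /\
    rCdn x <= Rdn * delta x /\
    rDdn x <= Rdn * (1 - delta x) /\
    rCup x <= Rup * delta x /\
    rDup x <= Rup * (1 - delta x) /\
    rdn x = rCdn x + rDdn x /\
    rup x = rCup x + rDup x /\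
    nonneg_vars x /\
    0 <= delta x <= 1].

(* Main.v *)
Require Import Defs.
From mathcomp Require Import all_boot all_order all_algebra.
From mathcomp Require Import classical_sets reals convex.
From mathcomp Require Import interval_inference ring lra.
Import Order.TTheory GRing.Theory Num.Theory.
Local Open Scope classical_set_scope.
Local Open Scope ring_scope.

(** [TOR_LP] is convex and [BOR_MIP] consists of its points with [delta] in
    {0, 1}.  A point of [TOR_LP] with [0 < delta < 1] is the [delta]-weighted
    average of a pure charging point (charging variables divided by [delta],
    discharging ones 0) and a pure discharging point (discharging variables
    divided by [1 - delta], charging ones 0).  The previous state of charge has
    to be split between the two within the ranges they allow: the power bounds
    make both ranges nonempty, and the two [TOR_LP] bounds on [soc_prev] say
    exactly that it lies between the weighted averages of their endpoints. *)

Lemma convex_combination_le {R : realDomainType} {t a b c d : R} :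
  0 <= t -> 0 <= 1 - t -> a <= b -> c <= d ->
  t * a + (1 - t) * c <= t * b + (1 - t) * d.
Proof. by move=> t0 t1 ab cd; rewrite lerD// ler_wpM2l. Qed.

(** One of the two points can always sit at an endpoint. If [z] is at least [t * b + (1 - t) * c],
    take [x = b] and solve for [y]; otherwise take [y = c] and solve for [x]. *)
Lemma split_convex_combination {R : realFieldType} {t a b c d z : R} :
  0 < t < 1 -> a <= b -> c <= d ->
  t * a + (1 - t) * c <= z <= t * b + (1 - t) * d ->
  exists x y, [/\ a <= x <= b, c <= y <= d & z = t * x + (1 - t) * y].
Proof.
move=> /andP[t0 t1] ab cd /andP[lez zle].
have t1' : 0 < 1 - t by rewrite subr_gt0.
have [h|/ltW h] := leP (t * b + (1 - t) * c) z.
  exists b, ((z - t * b) / (1 - t)); split.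
  - by rewrite ab lexx.
  - by rewrite ler_pdivlMr// ler_pdivrMr//; apply/andP; split; lra.
  - by field; rewrite gt_eqF.
exists ((z - (1 - t) * c) / t), c; split.
- by rewrite ler_pdivlMr// ler_pdivrMr//; apply/andP; split; lra.
- by rewrite cd lexx.
- by field; rewrite gt_eqF.
Qed.

Lemma sub_convex_hull {R : realType} {V : lmodType R} (A : set V) :
  A `<=` convex_hull A.
Proof. exact: sub_gen_smallest. Qed.

Lemma convex_hull_combination {R : realType} {V : lmodType R} (A : set V)
    (t : R) (x y : V) :
  0 <= t <= 1 -> A x -> A y -> convex_hull A (t *: x + (1 - t) *: y).
Proof.
move=> /andP[t0 t1] Ax Ay M [cM AM].
exact: set_mem (cM x y (Itv01 t0 t1) (mem_set (AM _ Ax)) (mem_set (AM _ Ay))).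
Qed.

Lemma TOR_LP_convex (R : realType)
    (Emax Emin PCmax PDmax Rup Rdn etaC etaD Delta : R) :
  convex_set (TOR_LP Emax Emin PCmax PDmax Rup Rdn etaC etaD Delta).
Proof.
move=> x y k /set_mem hx /set_mem hy; apply/mem_set.
have -> : conv k x y =
  k%:num *: (x : 'rV[R]_11) + (1 - k%:num) *: (y : 'rV[R]_11) by [].
have t0 : 0 <= k%:num by [].
have t1 : 0 <= 1 - k%:num by rewrite subr_ge0.
move: (k%:num) t0 t1 => t t0 t1 {k}.
move: hx hy; rewrite /TOR_LP /nonneg_vars /soc_balance /=.
rewrite /soc_prev /soc /pC /pD /rCup /rCdn /rDup /rDdn /rup /rdn /delta !mxE.
do 11 move: (x 0 _) => ?.
do 11 move: (y 0 _) => ?.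
move=> [-> [x1 [x2 [x3 [x4 [x5 [x6 [x7 [x8 [x9 [x10 [-> [->
  [[[x11 x12 x13 x14] [x15 x16 x17 x18]] /andP[x19 x20]]]]]]]]]]]]]]].
move=> [-> [y1 [y2 [y3 [y4 [y5 [y6 [y7 [y8 [y9 [y10 [-> [->
  [[[y11 y12 y13 y14] [y15 y16 y17 y18]] /andP[y19 y20]]]]]]]]]]]]]]].
(* Every constraint is affine, so each inequality is the weighted sum of its instances at the two
   points. *)
have E := fun a b c d => @convex_combination_le R t a b c d t0 t1.
split; first by ring.
split; first by have := E _ _ _ _ x1 y1; lra.
split; first by have := E _ _ _ _ x2 y2; lra.
split; first by have := E _ _ _ _ x3 y3; lra.
split; first by have := E _ _ _ _ x4 y4; lra.
split; first by have := E _ _ _ _ x5 y5; lra.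
split; first by have := E _ _ _ _ x6 y6; lra.
split; first by have := E _ _ _ _ x7 y7; lra.
split; first by have := E _ _ _ _ x8 y8; lra.
split; first by have := E _ _ _ _ x9 y9; lra.
split; first by have := E _ _ _ _ x10 y10; lra.
split; first by ring.
split; first by ring.
split.
  have := E _ _ _ _ x12 y12.
  by split; split; first [by rewrite addr_ge0 ?mulr_ge0 | lra].
apply/andP; split; first by rewrite addr_ge0 ?mulr_ge0.
by have := E _ _ _ _ x20 y20; lra.
Qed.

(** An integral [delta] switches one mode off: its power bound, with nonnegativity, makes all its
    variables vanish. The balance equation then turns the bounds on [soc] into those on [soc_prev].
    Conversely, the remaining bounds on [soc] follow since downward discharging and upward charging
    reserves never exceed the power. *)
Lemma BOR_MIP_eq (R : realType)
    (Emax Emin PCmax PDmax Rup Rdn etaC etaD Delta : R) :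
  0 <= etaC -> 0 <= etaD -> 0 <= Delta -> 0 <= Rup -> 0 <= Rdn ->
  BOR_MIP Emax Emin PCmax PDmax Rup Rdn etaC etaD Delta =
  TOR_LP Emax Emin PCmax PDmax Rup Rdn etaC etaD Delta `&`
    [set x | delta x = 0 \/ delta x = 1].
Proof.
move=> hC hD hDelta hRup hRdn.
have kC : 0 <= etaC * Delta by rewrite mulr_ge0.
have kD : 0 <= 1 / etaD * Delta by rewrite mulr_ge0// divr_ge0.
(* [lra] treats products of variables as atoms, so inequalities scaled by the conversion factors are
   supplied by hand. *)
have MC a b (ab : a <= b) := ler_wpM2l kC ab.
have MD a b (ab : a <= b) := ler_wpM2l kD ab.
apply/seteqP; split => x; rewrite /setI /TOR_LP /BOR_MIP /nonneg_vars /soc_balance /=;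
  move: (soc_prev x) (soc x) (pC x) (pD x) (rCup x) (rCdn x) (rDup x) (rDdn x)
    (rup x) (rdn x) (delta x) => e e' c d cu cd du dd u v dl {x}.
- move=> [x1 [ /andP[x2 x2'] [x3 [x4 [x5 [x6 [x7 [x8 [[x9 x9'] [[x10 x10']
    [[[x11 x12 x13 x14] [x15 x16 x17 x18]] xd]]]]]]]]]]].
  split=> //; case: xd => xd; subst dl.
  + have [c0 cu0 cd0] : [/\ c = 0, cu = 0 & cd = 0] by split; lra.
    subst c cu cd.
    have := MD _ _ x6; have := MD 0 _ x8.
    by do !split; try assumption; lra.
  + have [d0 du0 dd0] : [/\ d = 0, du = 0 & dd = 0] by split; lra.
    subst d du dd.
    have := MC 0 _ x7.
    by do !split; try assumption; lra.
- move=> [[x1 [x2 [x3 [x4 [x5 [x6 [x7 [x8 [x9 [x10 [x11 [x12 [x13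
    [[[y11 y12 y13 y14] [y15 y16 y17 y18]] _]]]]]]]]]]]]]] xd].
  split=> //; case: xd => xd; subst dl.
  + have [c0 cu0 cd0] : [/\ c = 0, cu = 0 & cd = 0] by split; lra.
    subst c cu cd.
    have := MD _ _ x7; have := MD 0 _ y14; have := MD 0 _ y17.
    by do !split; try assumption; lra.
  + have [d0 du0 dd0] : [/\ d = 0, du = 0 & dd = 0] by split; lra.
    subst d du dd.
    have := MC _ _ x6; have := MC 0 _ y13; have := MC 0 _ y16.
    by do !split; try assumption; lra.
Qed.

Lemma TOR_LP_decomposition (R : realType)
    (Emax Emin PCmax PDmax Rup Rdn etaC etaD Delta : R) (x : 'rV[R]_11) :
  0 <= Emin -> 0 < etaC -> 0 < etaD -> 0 < Delta ->
  PCmax <= 1 / (etaC * Delta) * (Emax - Emin) ->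
  PDmax <= etaD / Delta * (Emax - Emin) ->
  TOR_LP Emax Emin PCmax PDmax Rup Rdn etaC etaD Delta x ->
  0 < delta x < 1 ->
  exists x1 x0,
    [/\ TOR_LP Emax Emin PCmax PDmax Rup Rdn etaC etaD Delta x1 /\ delta x1 = 1,
        TOR_LP Emax Emin PCmax PDmax Rup Rdn etaC etaD Delta x0 /\ delta x0 = 0 &
        x = delta x *: x1 + (1 - delta x) *: x0].
Proof.
move=> hEmin hC hD hDelta hPC hPD + /andP[d0 d1].
rewrite {1}/TOR_LP /nonneg_vars /soc_balance /= => xP.
(* Listing the coordinates explicitly lets them be generalized to independent reals. *)
have xE : x = \row_i [:: soc_prev x; soc x; pC x; pD x; rCup x; rCdn x; rDup x;
    rDdn x; rup x; rdn x; delta x]`_i.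
  apply/rowP => i; rewrite mxE; case: i => [[|[|[|[|[|[|[|[|[|[|[|//]]]]]]]]]]] i] /=;
    by congr (x 0 _); exact: val_inj.
rewrite {1}xE; move: d0 d1 xP.
move: (soc_prev x) (soc x) (pC x) (pD x) (rCup x) (rCdn x) (rDup x) (rDdn x)
    (rup x) (rdn x) (delta x) => e e' c' d' cu' cd' du' dd' u v t {x xE}.
move=> t0 t1.
have t1' : 0 < 1 - t by rewrite subr_gt0.
(* Substituting [t * q] or [(1 - t) * q] for each variable avoids quotients: the power and reserve
   constraints acquire a common positive factor, which cancels. *)
have nC w : exists q, w = t * q by exists (w / t); field; rewrite gt_eqF.
have nD w : exists q, w = (1 - t) * q by exists (w / (1 - t)); field; rewrite gt_eqF.
have [[c ->] [cu ->] [cd ->]] := And3 (nC c') (nC cu') (nC cd').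
have [[d ->] [du ->] [dd ->]] := And3 (nD d') (nD du') (nD dd').
clear nC nD c' d' cu' cd' du' dd'.
move=> [-> [x2 [x3 [x4 [x5 [x6 [x7 [x8 [x9 [x10 [x11 [-> [->
    [[[_ _ y13 y14] [y15 y16 y17 y18]] _]]]]]]]]]]]]]].
move: y13 y14 y15 y16 y17 y18; rewrite !pmulr_rge0// => y13 y14 y15 y16 y17 y18.
move: x4 x5 x6 x7 x8 x9 x10 x11.
rewrite -!mulrDr -!mulrBr [PCmax * t]mulrC [PDmax * _]mulrC.
rewrite ![Rdn * _]mulrC ![Rup * _]mulrC.
rewrite !ler_pM2l// !pmulr_rge0// => x4 x5 x6 x7 x8 x9 x10 x11.
set kC := etaC * Delta; set kD := 1 / etaD * Delta.
have kC0 : 0 < kC by rewrite mulr_gt0.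
have kD0 : 0 < kD by rewrite mulr_gt0// divr_gt0.
have PC : kC * (c + cd) <= Emax - Emin.
  have := le_trans x4 hPC.
  by rewrite mulrAC mul1r ler_pdivlMr// mulrC.
have PD : kD * (d + du) <= Emax - Emin.
  have -> : Emax - Emin = kD * (etaD / Delta * (Emax - Emin)).
    by rewrite /kD; field; rewrite !gt_eqF.
  by rewrite ler_pM2l// (le_trans x5).
(* The first interval is the range of [soc_prev] for the charging point, the second that for the
   discharging point; [PC] and [PD] say that they are nonempty. *)
have [||||e1 [e0 [/andP[e1l e1u] /andP[e0l e0u] eE]]] :=
  @split_convex_combination _ t Emin (Emax - kC * (c + cd))
    (Emin + kD * (d + du)) Emax e.
- by rewrite t0 t1.
- by lra.
- by lra.
- by rewrite /kC /kD; apply/andP; split; lra.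
have MC a (a0 : 0 <= a) := mulr_ge0 (ltW kC0) a0.
have MD a (a0 : 0 <= a) := mulr_ge0 (ltW kD0) a0.
(* The final state of charge is dictated by the balance equation, and each total reserve reduces to
   that of the active mode. *)
exists (\row_i [:: e1; e1 + kC * c; c; 0; cu; cd; 0; 0; cu; cd; 1]`_i).
exists (\row_i [:: e0; e0 - kD * d; 0; d; 0; 0; du; dd; du; dd; 0]`_i).
split.
- rewrite /TOR_LP /nonneg_vars /soc_balance /=.
  rewrite /soc_prev /soc /pC /pD /rCup /rCdn /rDup /rDdn /rup /rdn /delta !mxE /=.
  have := MC _ y13; have := MC _ y16.
  move: e1l e1u; rewrite /kC => e1l e1u; clear - e1l e1u x4 x6 x8 x10 y13 y15 y16 hEmin.
  by move=> *; do !split; try assumption; lra.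
- rewrite /TOR_LP /nonneg_vars /soc_balance /=.
  rewrite /soc_prev /soc /pC /pD /rCup /rCdn /rDup /rDdn /rup /rdn /delta !mxE /=.
  have := MD _ y14; have := MD _ y17.
  move: e0l e0u; rewrite /kD => e0l e0u; clear - e0l e0u x5 x7 x9 x11 y14 y17 y18 hEmin.
  by move=> *; do !split; try assumption; lra.
apply/rowP => i; rewrite !mxE /kC /kD.
by case: i => [[|[|[|[|[|[|[|[|[|[|[|//]]]]]]]]]]] i] /=; rewrite ?eE; ring.
Qed.

Theorem theorem2 (R : realType)
    (Emax Emin PCmax PDmax Rup Rdn etaC etaD Delta : R)
    (hEmin : 0 <= Emin) (hEmax : Emin < Emax)
    (hDelta : 0 < Delta)
    (hetaC : 0 < etaC <= 1) (hetaD : 0 < etaD <= 1)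
    (hPC : 0 <= PCmax <= 1 / (etaC * Delta) * (Emax - Emin))
    (hRdn : 0 <= Rdn <= 1 / (etaC * Delta) * (Emax - Emin))
    (hPD : 0 <= PDmax <= etaD / Delta * (Emax - Emin))
    (hRup : 0 <= Rup <= etaD / Delta * (Emax - Emin)) :
  TOR_LP Emax Emin PCmax PDmax Rup Rdn etaC etaD Delta =
  convex_hull (BOR_MIP Emax Emin PCmax PDmax Rup Rdn etaC etaD Delta).
Proof.
move: hetaC hetaD hPC hRdn hPD hRup => /andP[hC _] /andP[hD _] /andP[_ hPC]
  /andP[hRdn _] /andP[_ hPD] /andP[hRup _].
have BE := @BOR_MIP_eq R Emax Emin PCmax PDmax _ _ _ _ _
  (ltW hC) (ltW hD) (ltW hDelta) hRup hRdn.
apply/seteqP; split; last first.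
  apply: smallest_sub; first exact: TOR_LP_convex.
  by rewrite BE; apply: subIsetl.
move=> x xP.
have /andP[d0 d1] : 0 <= delta x <= 1 by case: xP => ?; do 13 case=> ?.
(* At an integral [delta] the point itself lies in [BOR_MIP]; only a fractional one needs
   decomposing. *)
have [dx|dn0] := eqVneq (delta x) 0.
  by apply: sub_convex_hull; rewrite BE; split => //; left.
have [dx|dn1] := eqVneq (delta x) 1.
  by apply: sub_convex_hull; rewrite BE; split => //; right.
have [|x1 [x0 [[x1P x1d] [x0P x0d] ->]]] :=
  @TOR_LP_decomposition _ _ _ _ _ _ _ _ _ _ _ hEmin hC hD hDelta hPC hPD xP.
  by rewrite !lt_neqAle eq_sym dn0 d0 dn1.
apply: convex_hull_combination; first by rewrite d0.
- by rewrite BE; split => //; right.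
- by rewrite BE; split => //; left.
Qed.
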